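(* Let $(x_n)_{n\in\mathbb{Z}}$ be an increasing sequence of real numbers with $x_n=n+\varepsilon_n$, where $\varepsilon_n\ll E(|n|)$ as $n\to\pm\infty$ for some increasing function $E$. Define sequences $(x^j_n)_{n\in\mathbb{Z}}$, $j\ge 0$, by $x^0_n=x_n$ and $x^{j+1}_n=\frac12\bigl(x^j_n+x^j_{n+(-1)^j}\bigr)$. If $E(n)=o(n)$, then as $j\to\infty$ the sequence $(x^j_n)_n$ approaches equal spacing. Furthermore, if $E(n)\ll n^{\theta}$ with $0\le\theta<1$, then $$x^j_{n+1}-x^j_n=1+O\bigl((n^{\theta}+j^{\theta/2})j^{-1/2}\bigr).$$
   Context: The notation $A\ll B$ means $A=O(B)$. *)

(* Defs.v *)
From HB Require Import structures.
From mathcomp Require Import all_boot all_order all_algebra.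
From mathcomp Require Import all_classical all_reals all_analysis.
Import Order.TTheory GRing.Theory Num.Theory.
Import numFieldNormedType.Exports.

Set Implicit Arguments.
Unset Strict Implicit.
Unset Printing Implicit Defensive.

Local Open Scope classical_set_scope.
Local Open Scope ring_scope.

Fixpoint averaged (R : realType) (x : int -> R) (j : nat) (n : int) : R :=
  if j is i.+1 then
    2^-1 * (averaged x i n + averaged x i (n + (-1) ^+ i))
  else x n.

Definition gap (R : realType) (y : int -> R) (n : int) : R := y (n + 1) - y n.

(* The spacing is normalised to 1, the mean spacing of a sequence x_n = n + o(n).
   The convergence is pointwise in n: it cannot be uniform in n : int, because
   x may have arbitrarily long gaps far away from the origin. *)
Definition approaches_equal_spacing (R : realType) (y : nat -> int -> R) : Prop :=
  forall n : int, gap (y j) n @[j --> \oo] --> (1 : R).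

(* O(E(|n|)) as n -> +oo and as n -> -oo. *)
Definition bigO_two_sided (R : realType) (eps : int -> R) (E : nat -> R) : Prop :=
  ((fun k : nat => eps k%:Z : R^o) =O_\oo (E : nat -> R^o)) /\
  ((fun k : nat => eps (- k%:Z) : R^o) =O_\oo (E : nat -> R^o)).

(* Main.v *)
(** After [j] steps the sequence is a centred binomial average of [x], so the gap
    error is a binomial average of increments of [eps].  With [J = j + 1] and
    [S = 2 k - J] for [k] binomial of parameters [J], [1/2], summation by parts
    turns it into [(2 / J) E(S eps_(n - j./2 + k))].  Only the variance [E(S^2) = J]
    is then needed: an affine bound [|eps_m| <= a + b |m|] gives a gap error of at
    most [2 (a + b (|n| + 1)) / sqrt J + b].  For [eps_m = o(m)], [b] is arbitrarily
    small; for [eps_m = O(|m|^theta)], the affine bound is chosen at the scale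
    [max |n| (sqrt j)]. *)
Require Import Defs.
From HB Require Import structures.
From mathcomp Require Import all_boot all_order all_algebra.
From mathcomp Require Import all_classical all_reals all_analysis.
From mathcomp Require Import zify ring lra.
Import Order.TTheory GRing.Theory Num.Theory.
Import numFieldNormedType.Exports.

Local Open Scope classical_set_scope.
Local Open Scope ring_scope.

(** Pascal's rule summed against [g]: averaging neighbours once turns the weights of level [j] into
    those of level [j + 1]. *)
Lemma sum_bin_addS (R : comPzRingType) (j : nat) (g : nat -> R) :
  \sum_(k < j.+1) 'C(j, k)%:R * (g k + g k.+1) =
  \sum_(k < j.+2) 'C(j.+1, k)%:R * g k.
Proof.
rewrite [RHS]big_ord_recl bin0 mul1r.
under [in RHS]eq_bigr => i _ do rewrite /= /bump /= binS natrD mulrDl.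
under [in LHS]eq_bigr => i _ do rewrite mulrDr.
rewrite !big_split /= addrA; congr (_ + _).
rewrite big_ord_recl bin0 mul1r [in RHS]big_ord_recr /= bin_small// mul0r addr0.
by congr (_ + _).
Qed.

Lemma sum_bin (R : comPzRingType) (j : nat) :
  \sum_(k < j.+1) 'C(j, k)%:R = 2 ^+ j :> R.
Proof.
rewrite -[2]/(1 + 1) exprDn; apply: eq_bigr => i _.
by rewrite !expr1n mulr1.
Qed.

(** Summation by parts, or Stein's identity for the binomial law. With [J = j + 1], split
    [2 k - J = k - (J - k)] and absorb each factor: [k C(J, k) = J C(j, k - 1)] and
    [(J - k) C(J, k) = J C(j, k)]. *)
Lemma binomial_stein (R : comPzRingType) (j : nat) (f : nat -> R) :
  \sum_(k < j.+2) 'C(j.+1, k)%:R * ((2 * k%:R - j.+1%:R) * f k) =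
  j.+1%:R * \sum_(k < j.+1) 'C(j, k)%:R * (f k.+1 - f k).
Proof.
have up : j.+1%:R * \sum_(k < j.+1) 'C(j, k)%:R * f k.+1 =
          \sum_(k < j.+2) 'C(j.+1, k)%:R * (k%:R * f k).
  rewrite [RHS]big_ord_recl mul0r mulr0 add0r mulr_sumr.
  apply: eq_bigr => i _; rewrite /= /bump /= !mulrA -!natrM.
  by rewrite (mul_bin_diag j.+1) [(_ * i.+1)%N]mulnC.
have low : j.+1%:R * \sum_(k < j.+1) 'C(j, k)%:R * f k =
          \sum_(k < j.+2) 'C(j.+1, k)%:R * ((j.+1%:R - k%:R) * f k).
  rewrite [RHS]big_ord_recr /= subrr mul0r mulr0 addr0 mulr_sumr.
  apply: eq_bigr => i _; rewrite -natrB; last exact/ltnW.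
  by rewrite !mulrA -!natrM (mul_bin_down j.+1) [(_ * (_ - i))%N]mulnC.
under [in RHS]eq_bigr => i _ do rewrite mulrBr.
rewrite sumrB mulrBr up low -sumrB; apply: eq_bigr => i _.
ring.
Qed.

(** Stein's identity applied to [f k = 2 k - J] itself, whose increments all equal 2. *)
Lemma binomial_variance (R : comPzRingType) (j : nat) :
  \sum_(k < j.+2) 'C(j.+1, k)%:R * (2 * k%:R - j.+1%:R) ^+ 2 =
  j.+1%:R * 2 ^+ j.+1 :> R.
Proof.
under eq_bigr => i _ do rewrite expr2.
rewrite (@binomial_stein _ j (fun k => 2 * k%:R - j.+1%:R)) exprSr -sum_bin.
rewrite mulr_suml; congr (_ * _); apply: eq_bigr => i _.
rewrite [i.+1%:R]mulrS; ring.
Qed.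

(** Steps of even index average with the right neighbour, those of odd index with the left one, so
    the left end of the window moves only at the latter: [j./2] times in [j] steps. *)
Lemma averagedE (R : realType) (x : int -> R) (j : nat) (n : int) :
  averaged x j n =
  2^-1 ^+ j * \sum_(k < j.+1) 'C(j, k)%:R * x (n - (j./2)%:Z + k%:Z).
Proof.
elim: j n => [|j IH] n /=.
  by rewrite big_ord_recl big_ord0 bin0 expr0 addr0 !mul1r subr0 addr0.
rewrite !IH -mulrDr exprS mulrA; congr (_ * _).
rewrite -(@sum_bin_addS _ j (fun k => x (n - (uphalf j)%:Z + k%:Z))) -big_split.
apply: eq_bigr => i _ /=; rewrite -mulrDr; congr (_ * _).
(* For odd [j] the neighbour lies on the left, and the two terms of Pascal's rule come in swapped
   order. *)
rewrite -signr_odd uphalf_half; case: (odd j) => /=.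
  by rewrite addrC; congr (x _ + x _); lia.
by congr (x _ + x _); lia.
Qed.

Lemma gap_averagedE {R : realType} {x eps : int -> R} (j : nat) (n : int) :
  (forall m, x m = m%:~R + eps m) ->
  gap (averaged x j) n - 1 =
  2^-1 ^+ j / j.+1%:R * \sum_(k < j.+2) 'C(j.+1, k)%:R *
    ((2 * k%:R - j.+1%:R) * eps (n - (j./2)%:Z + k%:Z)).
Proof.
move=> xE; rewrite (@binomial_stein _ j (fun k => eps (n - (j./2)%:Z + k%:Z))).
rewrite mulrA divfK ?pnatr_eq0// /gap !averagedE -mulrBr -sumrB.
(* The 1 is written as a binomial mean, so that it cancels termwise against the integer part of the
   increments of [x]. *)
have one : 1 = 2^-1 ^+ j * \sum_(k < j.+1) 'C(j, k)%:R :> R.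
  by rewrite sum_bin -exprMn mulVf ?expr1n.
rewrite [X in _ - X = _]one.
rewrite -mulrBr -sumrB; congr (_ * _); apply: eq_bigr => i _.
have -> : n + 1 - (j./2)%:Z + i%:Z = n - (j./2)%:Z + i.+1%:Z by lia.
rewrite !xE -mulrBr -[X in _ - X]mulr1 -mulrBr; congr (_ * _).
rewrite -addn1 PoszD addrA [in (_ + 1)%:~R]intrD; ring.
Qed.

Lemma gap_averaged_le {R : realType} {x eps : int -> R} {a b : R}
    (j : nat) (n : int) :
  0 <= a -> 0 <= b -> (forall m, x m = m%:~R + eps m) ->
  (forall m, `|eps m| <= a + b * `|m%:~R|) ->
  `|gap (averaged x j) n - 1| <=
    2 * (a + b * (`|n%:~R| + 1)) / Num.sqrt j.+1%:R + b.
Proof.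
move=> a0 b0 xE epsle; rewrite (gap_averagedE j n xE).
set J : R := j.+1%:R; set c := a + b * _; set s := Num.sqrt J.
have J0 : 0 < J by rewrite ltr0n.
have s0 : 0 < s by rewrite sqrtr_gt0.
have sJ : s ^+ 2 = J by rewrite sqr_sqrtr// ltW.
have c0 : 0 <= c by rewrite addr_ge0// mulr_ge0// addr_ge0.
(* A constant plus a multiple of [S ^ 2], so that total mass and variance suffice. Since the mean of
   [S ^ 2] is [J = s ^ 2], the factor [2 / J] turns each of the two terms in [c] into [c / s], and
   the term in [b] into [b]. *)
have term (k : nat) : `|(2 * k%:R - J) * eps (n - (j./2)%:Z + k%:Z)| <=
    c * s / 2 + (c / (2 * s) + b / 2) * (2 * k%:R - J) ^+ 2.
  set S := 2 * k%:R - J.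
  have idx : `|(n - (j./2)%:Z + k%:Z)%:~R : R| <= `|n%:~R| + (`|S| / 2 + 1).
    rewrite !intrD -addrA (le_trans (ler_normD _ _))// lerD2l.
    (* The window is off centre by 1/2 or 1 according to the parity of [j]; hence the [+ 1] in
       [c]. *)
    have -> : (- (j./2)%:Z)%:~R + k%:Z%:~R = (S + (1 + (odd j)%:R)) / 2 :> R.
      have jE : j%:R = (odd j)%:R + 2 * (j./2)%:R :> R.
        by rewrite -natrM mul2n -natrD odd_double_half.
      rewrite /S /J mulrNz -!pmulrn [j.+1%:R]mulrS jE.
      by field.
    rewrite normrM [`|2^-1|]ger0_norm ?invr_ge0//.
    have : `|S + (1 + (odd j)%:R)| <= `|S| + 2.
      rewrite (le_trans (ler_normD _ _))// lerD2l ger0_norm ?addr_ge0//.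
      by case: (odd j) => /=; lra.
    lra.
  (* AM-GM: [2 |S| <= s + S^2 / s] *)
  have amgm : `|S| <= s / 2 + S ^+ 2 / (2 * s).
    rewrite -subr_ge0 -real_normK ?num_real//.
    have -> : s / 2 + `|S| ^+ 2 / (2 * s) - `|S| = (s - `|S|) ^+ 2 / (2 * s).
      by field; rewrite gt_eqF.
    by rewrite divr_ge0 ?sqr_ge0// mulr_ge0// ltW.
  have epsS : `|eps (n - (j./2)%:Z + k%:Z)| <= c + b / 2 * `|S|.
    apply: (le_trans (epsle _)); have := ler_wpM2l b0 idx.
    by rewrite /c; lra.
  rewrite normrM; apply: le_trans (ler_wpM2l (normr_ge0 _) epsS) _.
  have := ler_wpM2r c0 amgm.
  have -> : `|S| * (c + b / 2 * `|S|) = `|S| * c + b / 2 * `|S| ^+ 2 by ring.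
  rewrite real_normK ?num_real//.
  have -> : (s / 2 + S ^+ 2 / (2 * s)) * c = c * s / 2 + c / (2 * s) * S ^+ 2.
    by field; rewrite gt_eqF.
  lra.
have w0 : 0 <= 2^-1 ^+ j / J by rewrite divr_ge0 ?exprn_ge0 ?invr_ge0// ltW.
rewrite normrM [`|2^-1 ^+ j / J|]ger0_norm//.
apply: (@le_trans _ _ (2^-1 ^+ j / J * \sum_(k < j.+2) ('C(j.+1, k)%:R *
    (c * s / 2 + (c / (2 * s) + b / 2) * (2 * k%:R - J) ^+ 2)))).
  rewrite ler_wpM2l//; apply: le_trans (ler_norm_sum _ _ _) _.
  by apply: ler_sum => i _; rewrite normrM normr_nat ler_wpM2l.
under eq_bigr => i _ do rewrite mulrDr [_ * ((_ + _) * _)]mulrCA.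
rewrite big_split /= -mulr_suml -mulr_sumr sum_bin binomial_variance -/J.
rewrite exprVn exprS -sJ le_eqVlt; apply/orP; left; apply/eqP.
by field; rewrite expf_neq0//= gt_eqF.
Qed.

(** The finitely many exceptional indices are absorbed into [K], the sum of their values. *)
Lemma near_infty_le_add {R : realType} {u v : nat -> R} :
  (forall k, 0 <= v k) -> (\forall k \near \oo, `|u k| <= v k) ->
  exists2 K : R, 0 <= K & forall k, `|u k| <= K + v k.
Proof.
move=> v0 [N _ uv]; exists (\sum_(i < N) `|u i|); first exact: sumr_ge0.
move=> k; have [kN|Nk] := ltnP k N; last first.
  by rewrite ler_wpDl ?sumr_ge0//; exact: uv.
by rewrite (bigD1 (Ordinal kN))//= -addrA lerDl addr_ge0// sumr_ge0.
Qed.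

Lemma near_infty_le_add_int {R : realType} {eps : int -> R} {v : nat -> R} :
  (forall k, 0 <= v k) ->
  (\forall k \near \oo, `|eps k%:Z| <= v k) ->
  (\forall k \near \oo, `|eps (- k%:Z)| <= v k) ->
  exists2 K : R, 0 <= K & forall m, `|eps m| <= K + v `|m|%N.
Proof.
move=> v0 /(near_infty_le_add v0)[K K0 epsK] /(near_infty_le_add v0)[L L0 epsL].
exists (K + L); first exact: addr_ge0.
case=> k; first by rewrite addrAC ler_wpDr.
by rewrite NegzE abszN absz_nat -addrA ler_wpDl.
Qed.

(** Below [T] this is monotonicity; above it, [(t / T) ^ theta <= t / T] because [theta <= 1]. *)
Lemma powR_le_affine {R : realType} (theta t T : R) :
  0 <= theta -> theta <= 1 -> 0 <= t -> 0 < T ->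
  t `^ theta <= T `^ theta + T `^ theta / T * t.
Proof.
move=> th0 th1 t0 T0; have [tT|/ltW Tt] := leP t T.
  rewrite ler_wpDr ?mulr_ge0 ?powR_ge0 ?invr_ge0 ?(ltW T0)//.
  by apply: ge0_ler_powR; rewrite ?nnegrE// ltW.
have tE : t = T * (t / T) by rewrite mulrC divfK// gt_eqF.
rewrite {1}tE powRM ?divr_ge0 ?(ltW T0)// -mulrA [T^-1 * t]mulrC.
rewrite ler_wpDl ?powR_ge0// ler_wpM2l ?powR_ge0//.
by rewrite ler1_powR// ler_pdivlMr// mul1r.
Qed.

Lemma gap_averaged_cvg1 {R : realType} {x eps : int -> R} :
  (forall m, x m = m%:~R + eps m) ->
  (forall b : R, 0 < b ->
     exists2 a : R, 0 <= a & forall m, `|eps m| <= a + b * `|m%:~R|) ->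
  approaches_equal_spacing (averaged x).
Proof.
move=> xE epso n; apply/cvgrPdist_le => e e0.
(* The slope [e / 2] costs half of [e] for every [j]; the rest is [c / sqrt J], at most [e / 2] once
   [j >= (2 c / e) ^ 2]. *)
have e20 : 0 < e / 2 by rewrite divr_gt0.
have [a a0 epsa] := epso _ e20.
set c := 2 * (a + e / 2 * (`|n%:~R| + 1)).
have c0 : 0 <= c by rewrite mulr_ge0// addr_ge0// mulr_ge0 ?addr_ge0// ltW.
near=> j.
have s0 : 0 < Num.sqrt j.+1%:R :> R by rewrite sqrtr_gt0.
rewrite distrC (le_trans (gap_averaged_le j n a0 (ltW e20) xE epsa))// -/c.
suff : c / Num.sqrt j.+1%:R <= e / 2 by lra.
have q0 : 0 <= c / (e / 2) by exact: divr_ge0 c0 (ltW e20).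
rewrite ler_pdivrMr// mulrC -ler_pdivrMr// -[leLHS]ger0_norm// -sqrtr_sqr ler_wsqrtr//.
have jc : (c / (e / 2)) ^+ 2 <= j%:R by near: j; exact: nbhs_infty_ger.
by rewrite (le_trans jc)// ler_nat.
Unshelve. all: by end_near. Qed.

Lemma gap_averaged_le_powR {R : realType} {x eps : int -> R} {theta K c : R} :
  0 <= theta -> theta <= 1 -> 0 <= K -> 0 <= c ->
  (forall m, x m = m%:~R + eps m) ->
  (forall m, `|eps m| <= K + c * `|m%:~R| `^ theta) ->
  forall (n : int) (j : nat), (0 < j)%N ->
  `|gap (averaged x j) n - 1| <= (2 * K + 7 * c) *
    ((`|n%:~R| `^ theta + j%:R `^ (theta / 2)) * j%:R `^ (- 2^-1)).
Proof.
move=> th0 th1 K0 c0 xE epsle n j j0.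
set s : R := Num.sqrt j%:R.
have s1 : 1 <= s by rewrite -sqrtr1 ler_wsqrtr// ler1n.
have s0 : 0 < s by exact: lt_le_trans s1.
(* The affine bound is taken at the larger of the two scales [n] and [sqrt j]. *)
set T := Num.max `|n%:~R| s.
have sT : s <= T by rewrite le_max lexx orbT.
have nT : `|n%:~R| <= T by rewrite le_max lexx.
have T0 : 0 < T by exact: lt_le_trans sT.
set P := T `^ theta.
have P1 : 1 <= P by rewrite -(powRr0 T) ler_powR// (le_trans s1).
have P0 : 0 <= P by exact: le_trans P1.
have cPT0 : 0 <= c * (P / T) by rewrite mulr_ge0// divr_ge0// ltW.
have a0 : 0 <= K + c * P by rewrite addr_ge0// mulr_ge0.
have epsT m : `|eps m| <= K + c * P + c * (P / T) * `|m%:~R|.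
  apply: le_trans (epsle m) _; rewrite -addrA lerD2l -mulrA -mulrDr.
  by rewrite ler_wpM2l// powR_le_affine.
apply: le_trans (gap_averaged_le j n a0 cPT0 xE epsT) _.
have sJ : s <= Num.sqrt j.+1%:R by rewrite ler_wsqrtr// ler_nat.
have -> : j%:R `^ (- 2^-1) = s^-1 :> R by rewrite powRN powR12_sqrt.
have -> : j%:R `^ (theta / 2) = s `^ theta.
  by rewrite mulrC powRrM powR12_sqrt.
have PTh : P <= `|n%:~R| `^ theta + s `^ theta.
  by rewrite /P /T; case: (leP `|n%:~R| s) => _; rewrite (lerDl, lerDr) powR_ge0.
apply: (@le_trans _ _ ((2 * K + 7 * c) * (P / s))); last first.
  by rewrite ler_wpM2l ?addr_ge0 ?mulr_ge0// ler_wpM2r ?invr_ge0// ltW.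
have PTs : P / T <= P / s by rewrite ler_wpM2l// lef_pV2.
(* Here [P >= 1] gives [K <= K P], and [|n| + 1 <= 2 T] gives [3 c = c + 2 c]. Doubling and adding
   the slope term yields [2 K + 7 c]. *)
have num : K + c * P + c * (P / T) * (`|n%:~R| + 1) <= K * P + 3 * c * P.
  have KP : K <= K * P by rewrite ler_peMr.
  have nT2 : `|n%:~R| + 1 <= 2 * T by lra.
  have := ler_wpM2l cPT0 nT2.
  have -> : c * (P / T) * (2 * T) = 2 * c * P by field; rewrite gt_eqF.
  lra.
have inv : (Num.sqrt j.+1%:R)^-1 <= s^-1 :> R.
  by rewrite lef_pV2 ?posrE// (lt_le_trans s0).
have sJ0 : 0 <= (Num.sqrt j.+1%:R)^-1 :> R by rewrite invr_ge0 sqrtr_ge0.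
have cPT : c * (P / T) <= c * (P / s) by rewrite ler_wpM2l.
have fst : 2 * (K + c * P + c * (P / T) * (`|n%:~R| + 1)) / Num.sqrt j.+1%:R <=
    2 * (K * P + 3 * c * P) / s.
  apply: ler_pM => //; last by rewrite ler_wpM2l.
  by rewrite mulr_ge0// addr_ge0// mulr_ge0// addr_ge0.
apply: le_trans (lerD fst cPT) _.
by rewrite le_eqVlt; apply/orP; left; apply/eqP; field; rewrite gt_eqF.
Qed.

Theorem theorem3p1 (R : realType) (x eps : int -> R) (E : nat -> R)
    (x_incr : {homo x : m n / m <= n})
    (xE : forall n : int, x n = n%:~R + eps n)
    (E_incr : {homo E : m n / (m <= n)%N >-> m <= n})
    (epsO : bigO_two_sided eps E) :
  ((E : nat -> R^o) =o_\oo (fun n : nat => n%:R : R^o) ->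
     approaches_equal_spacing (averaged x)) /\
  (forall theta : R, 0 <= theta -> theta < 1 ->
     (E : nat -> R^o) =O_\oo (fun n : nat => n%:R `^ theta : R^o) ->
     exists C : R, forall (n : int) (j : nat), (0 < j)%N ->
       `|gap (averaged x j) n - 1| <=
         C * ((`|n|%:~R `^ theta + j%:R `^ (theta / 2)) * j%:R `^ (- 2^-1))).
Proof.
case: epsO => /eqO_exP[c1 c10 eps1] /eqO_exP[c2 c20 eps2].
(* Transitivity of the O-bounds; [c1 + c2] serves both directions at once. *)
have bound (b : R) (v : nat -> R) : 0 <= b -> (forall k, 0 <= v k) ->
    (\forall k \near \oo, `|E k| <= b * v k) ->
    exists2 K : R, 0 <= K &
      forall m, `|eps m| <= K + (c1 + c2) * b * v `|m|%N.
  move=> b0 v0 Eb.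
  apply: (@near_infty_le_add_int _ eps (fun k => (c1 + c2) * b * v k)).
  - by move=> k; rewrite !mulr_ge0// addr_ge0// ltW.
  - apply: filterS2 eps1 Eb => k e1 Ek; apply: (le_trans e1).
    by rewrite -mulrA ler_pM// ?ler_wpDr// ltW.
  - apply: filterS2 eps2 Eb => k e2 Ek; apply: (le_trans e2).
    by rewrite -mulrA ler_pM// ?ler_wpDl// ltW.
have c0 : 0 < c1 + c2 by rewrite addr_gt0.
split=> [/eqoP Eo|theta th0 /ltW th1 /eqO_exP[c3 c30 E3]].
  apply: (gap_averaged_cvg1 xE) => b b0.
  (* Dividing by [c1 + c2] makes the resulting slope for [eps] exactly [b]. *)
  have bc0 : 0 < b / (c1 + c2) by rewrite divr_gt0.
  have Eb : \forall k \near \oo, `|E k| <= b / (c1 + c2) * k%:R.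
    by apply: filterS (Eo _ bc0) => k; rewrite normr_nat.
  have [K K0 epsK] := bound _ _ (ltW bc0) (fun k => ler0n R k) Eb.
  exists K => // m; apply: le_trans (epsK m) _.
  by rewrite mulrCA divff ?gt_eqF// mulr1 natr_absz intr_norm.
have E3' : \forall k \near \oo, `|E k| <= c3 * k%:R `^ theta.
  by apply: filterS E3 => k; rewrite [X in _ <= _ * X]ger0_norm ?powR_ge0.
have [K K0 epsK] := bound _ _ (ltW c30) (fun k => powR_ge0 k%:R theta) E3'.
exists (2 * K + 7 * ((c1 + c2) * c3)) => n j j0; rewrite intr_norm.
apply: (gap_averaged_le_powR th0 th1 K0 _ xE _ _ _ j0).
  by rewrite mulr_ge0// ltW.
by move=> m; have := epsK m; rewrite natr_absz intr_norm.
Qed.
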